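(* Let $a=(a_n)_{n=1}^\infty$ be a sequence of real numbers with generating function $a(t)=\sum_{n\ge 0}a_{n+1}t^n$. Let $I^{(-1)}(a)$ be the sequence whose generating function is the formal power series $\dfrac{a(t)}{1+t\,a(t)}$. Then there exists a coloration $X$ such that, for every $n\ge 1$, $a_n$ is the number of colored compositions of $n$ with coloration $X$, if and only if $I^{(-1)}(a)$ is a sequence of non-negative integers. In this case $X=I^{(-1)}(a)$, i.e. $X=(x_i)_{i=1}^\infty$ with $\sum_{n\ge 0}x_{n+1}t^n=\dfrac{a(t)}{1+t\,a(t)}$.
   Context: A coloration is a sequence $X=(x_i)_{i=1}^\infty$ of non-negative integers; $x_i$ is the number of available colors of a part of size $i$ (if $x_i=0$, the part $i$ is not used). A colored composition of $n\ge 1$ with coloration $X$ is a finite ordered sequence of parts, each part being a positive integer $i$ (its size) together with one of its $x_i$ colors, such that the sizes sum to $n$. The Invert interpolated operator $I^{(x)}$ with parameter $x\in\mathbb R$ transforms a sequence with ordinary generating function $a(t)$ into the sequence with ordinary generating function $\dfrac{a(t)}{1-x\,t\,a(t)}$. In these generating functions the first term of a sequence is the coefficient of $t^0$, even when the sequence is indexed from $1$. *)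

(* Defs.v *)
From HB Require Import structures.
From mathcomp Require Import all_boot all_order all_algebra finmap.
From mathcomp Require Import boolp classical_sets functions cardinality reals.

Set Implicit Arguments.
Unset Strict Implicit.
Unset Printing Implicit Defensive.

Import Order.TTheory GRing.Theory Num.Theory.
Local Open Scope classical_set_scope.
Local Open Scope ring_scope.

(* A record rather than an alias of [nat -> R], whose canonical ring structure
   is pointwise. *)
Record fps (R : Type) := Fps { fps_coef :> nat -> R }.

Lemma fpsP (R : Type) (f g : fps R) : f =1 g -> f = g.
Proof. by case: f g => [f] [g] /= fg; congr Fps; apply/funext. Qed.

HB.instance Definition _ (R : Type) := gen_eqMixin (fps R).
HB.instance Definition _ (R : Type) := gen_choiceMixin (fps R).

Section FpsRing.
Context {R : fieldType}.
Implicit Types (f g h : fps R) (n i : nat).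

Definition fps_const (c : R) : fps R := Fps (fun n => if n is 0 then c else 0).
Definition fps_var : fps R := Fps (fun n => (n == 1%N)%:R).

Definition fps_add f g : fps R := Fps (fun n => f n + g n).
Definition fps_opp f : fps R := Fps (fun n => - f n).
Definition fps_mul f g : fps R :=
  Fps (fun n => \sum_(i < n.+1) f i * g (n - i)%N).

Fact fps_addA : associative fps_add.
Proof. by move=> f g h; apply: fpsP => n /=; rewrite addrA. Qed.
Fact fps_addC : commutative fps_add.
Proof. by move=> f g; apply: fpsP => n /=; rewrite addrC. Qed.
Fact fps_add0 : left_id (fps_const 0) fps_add.
Proof. by move=> f; apply: fpsP => -[|n] /=; rewrite add0r. Qed.
Fact fps_addN : left_inverse (fps_const 0) fps_opp fps_add.
Proof. by move=> f; apply: fpsP => -[|n] /=; rewrite addNr. Qed.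

HB.instance Definition _ := GRing.isZmodule.Build (fps R)
  fps_addA fps_addC fps_add0 fps_addN.

Let trunc n f : {poly R} := \poly_(i < n.+1) f i.

Let trunc_mul n f g k : (k <= n)%N ->
  (trunc n f * trunc n g)`_k = fps_mul f g k.
Proof.
move=> kn; rewrite coefM; apply: eq_bigr => -[i /= ik] _.
by rewrite !coef_poly !ltnS (leq_trans _ kn) ?(leq_trans (leq_subr _ _) kn).
Qed.

Fact fps_mulC : commutative fps_mul.
Proof.
by move=> f g; apply: fpsP => n; rewrite -!(@trunc_mul n) // mulrC.
Qed.

Fact fps_mulA : associative fps_mul.
Proof.
move=> f g h; apply: fpsP => n.
transitivity (trunc n f * (trunc n g * trunc n h))`_n.
  rewrite coefM; apply: eq_bigr => -[i /= ik] _.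
  by rewrite trunc_mul ?leq_subr// coef_poly ik.
rewrite mulrA coefM; apply: eq_bigr => -[i /= ik] _.
by rewrite trunc_mul// coef_poly ltnS leq_subr.
Qed.

Fact fps_mul1 : left_id (fps_const 1) fps_mul.
Proof.
move=> f; apply: fpsP => n /=; rewrite big_ord_recl /= mul1r subn0.
by rewrite big1 ?addr0// => i _; rewrite mul0r.
Qed.

Fact fps_mulDl : left_distributive fps_mul fps_add.
Proof.
move=> f g h; apply: fpsP => n /=; rewrite -big_split /=.
by apply: eq_bigr => i _; rewrite mulrDl.
Qed.

Fact fps_1neq0 : fps_const 1 != 0.
Proof.
apply/eqP => /(congr1 (fun f : fps R => f 0%N)) /= /eqP.
by rewrite oner_eq0.
Qed.

HB.instance Definition _ := GRing.Zmodule_isComNzRing.Build (fps R)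
  fps_mulA fps_mulC fps_mul1 fps_mulDl fps_1neq0.

Lemma coef_fpsD f g n : (f + g) n = f n + g n. Proof. by []. Qed.
Lemma coef_fpsN f n : (- f) n = - f n. Proof. by []. Qed.
Lemma coef_fpsM f g n : (f * g) n = \sum_(i < n.+1) f i * g (n - i)%N.
Proof. by []. Qed.
Lemma coef_fps1 n : (1 : fps R) n = (n == 0%N)%:R. Proof. by case: n. Qed.

Definition fps_unit : {pred fps R} := fun f => f 0%N != 0.

(* The coefficients of the inverse of f, computed from f * f^-1 = 1. *)
Fixpoint fps_inv_seq f n : seq R :=
  if n is m.+1 then
    let s := fps_inv_seq f m in
    rcons s ((f 0%N)^-1 * ((m == 0%N)%:R - \sum_(i < m) s`_i * f (m - i)%N))
  else [::].

(* Outside the units the inverse is the identity, as required by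
   [unitRingType]. *)
Definition fps_inv f : fps R :=
  if f 0%N != 0 then Fps (fun n => (fps_inv_seq f n.+1)`_n) else f.

Let size_inv_seq f n : size (fps_inv_seq f n) = n.
Proof. by elim: n => //= n IH; rewrite size_rcons IH. Qed.

Let nth_inv_seq f n i : (i < n)%N ->
  (fps_inv_seq f n)`_i = (fps_inv_seq f i.+1)`_i.
Proof.
elim: n => // n IH; rewrite ltnS leq_eqVlt => /predU1P[->//|lin].
by rewrite {1}/fps_inv_seq -/fps_inv_seq nth_rcons size_inv_seq lin IH.
Qed.

Fact fps_mulVx : {in fps_unit, left_inverse 1 fps_inv *%R}.
Proof.
move=> f; rewrite unfold_in /fps_unit => f0; apply: fpsP => n.
rewrite coef_fpsM coef_fps1 /fps_inv f0 big_ord_recr /= subnn.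
rewrite nth_rcons size_inv_seq ltnn eqxx mulrC mulrA divff// mul1r.
rewrite addrC -addrA [X in _ + X](_ : _ = 0) ?addr0// addrC; apply/eqP.
rewrite subr_eq0; apply/eqP; apply: eq_bigr => i _.
by rewrite (nth_inv_seq _ (ltn_ord i)).
Qed.

Fact fps_unitPl f g : g * f = 1 -> fps_unit f.
Proof.
move/(congr1 (fun f : fps R => f 0%N)); rewrite coef_fpsM big_ord1 coef_fps1 /=.
move=> gf1; rewrite /fps_unit; apply/eqP => f0; move/eqP: gf1.
by rewrite subn0 f0 mulr0 eq_sym oner_eq0.
Qed.

Fact fps_inv_out : {in [predC fps_unit], fps_inv =1 id}.
Proof. by move=> f; rewrite inE unfold_in /fps_unit /fps_inv => /negPf ->. Qed.

HB.instance Definition _ := GRing.ComNzRing_hasMulInverse.Build (fps R)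
  fps_mulVx fps_unitPl fps_inv_out.

Lemma fps_unitE f : (f \is a GRing.unit) = (f 0%N != 0).
Proof. by []. Qed.

End FpsRing.

(* A sequence (u_n)_{n >= 1} is encoded as u : nat -> R, where the value u 0 is
   irrelevant; its first term u 1 is the coefficient of t^0. *)
Definition gen_fun (R : Type) (u : nat -> R) : fps R := Fps (fun n => u n.+1).

Definition seq_of_gen_fun (R : Type) (f : fps R) : nat -> R := fun n => f n.-1.

Lemma seq_of_gen_funK (R : Type) (f : fps R) : gen_fun (seq_of_gen_fun f) = f.
Proof. exact: fpsP. Qed.

Definition invert (R : fieldType) (x : R) (a : nat -> R) : nat -> R :=
  seq_of_gen_fun
    (gen_fun a / (1 - fps_const x * fps_var * gen_fun a)).

(* The denominator is always a unit, so the quotient above is a true one. *)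
Lemma invert_denom_unit (R : fieldType) (x : R) (a : nat -> R) :
  1 - fps_const x * fps_var * gen_fun a \is a GRing.unit.
Proof.
rewrite fps_unitE coef_fpsD coef_fpsN !coef_fpsM big_ord1 coef_fpsM big_ord1 /=.
by rewrite mulr0 mul0r subr0 oner_neq0.
Qed.

(* X i is the number of colors of the parts of size i; X 0 is irrelevant. *)
Definition coloration := nat -> nat.

Definition colored_part (X : coloration) := {i : nat & 'I_(X i)}.

Definition colored_compositions (X : coloration) (n : nat) :
    set (seq (colored_part X)) :=
  [set s | all (fun p => 0 < tag p)%N s /\ (\sum_(p <- s) tag p = n)%N].
Arguments colored_compositions X n : clear implicits.

Lemma finite_colored_compositions (X : coloration) (n : nat) :
  finite_set (colored_compositions X n).
Proof.
pose P := [seq Tagged (fun i => 'I_(X i)) c | i <- iota 0 n.+1, c <- enum 'I_(X i)].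
pose B k := [set s : seq (colored_part X) | (size s <= k)%N /\ {subset s <= P}].
have finB k : finite_set (B k).
  elim: k => [|k IH].
    apply: (@sub_finite_set _ _ [set [::]]); last exact: finite_set1.
    by move=> s [+ _]; rewrite leqn0 size_eq0 => /eqP.
  apply: (@sub_finite_set _ _
    ([set [::]] `|` [set p :: s | p in [set` P] & s in B k])).
    move=> [|p s] [/= ss sP]; first by left.
    right; exists p; first by apply: sP; rewrite mem_head.
    exists s => //; split=> // q qs; apply: sP.
    by rewrite inE qs orbT.
  rewrite finite_setU; split; first exact: finite_set1.
  by apply: finite_image2 => //; exact: finite_seq.
apply: sub_finite_set (finB n) => s [/allP s0 sn]; split.
  rewrite -sn -sum1_size big_seq [leqRHS]big_seq.
  by apply: leq_sum => p ps; exact: s0.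
move=> [i c] ps; apply/allpairsPdep; exists i, c; rewrite mem_enum mem_iota.
split=> //; rewrite /= add0n ltnS -sn.
by rewrite (perm_big _ (perm_to_rem ps)) big_cons /= leq_addr.
Qed.

Definition num_colored_compositions (X : coloration) (n : nat) : nat :=
  #|` fset_set (colored_compositions X n)|%fset.

Definition counts_colored_compositions (R : pzSemiRingType) (X : coloration)
    (a : nat -> R) : Prop :=
  forall n : nat, (1 <= n)%N -> a n = (num_colored_compositions X n)%:R.

(* Main.v *)
Require Import Defs.
From mathcomp Require Import all_boot all_order all_algebra reals.
From mathcomp Require Import finmap boolp classical_sets cardinality.
Import GRing.Theory Num.Theory.
Local Open Scope ring_scope.

(** Write [A] for the generating function of [a], [Z] for that of a coloration
    and [t] for the variable.  Removing the first part of a composition gives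
    [A = Z * (1 + t * A)] when [a] counts the compositions colored by the
    coloration ([gen_fun_colored_compositions]): [Z] records the first part,
    and [1 + t * A] records the remainder, which is again a composition, this
    time possibly empty.  Since [1 + t * A] is invertible, this equation is
    [Z = A / (1 + t * A)], so the coloration is determined by [a], and
    [I^(-1)(a)] consists of natural numbers.

    Conversely, if the coefficients of [A / (1 + t * A)] are natural numbers,
    they are a coloration, and both [A] and the generating function of the
    composition counts of that coloration solve [U = Z * (1 + t * U)].  This
    equation is linear in [U], with [1 - t * Z] as the invertible coefficient
    of [U], so the two solutions coincide ([first_part_eq_inj]). *)

(** An explicit list, because the type of parts may be infinite: nonempty
    compositions are enumerated by running through their first part. *)
Definition parts_upto (X : coloration) (n : nat) : seq (colored_part X) :=
  [seq Tagged (fun i => 'I_(X i)) c | i <- iota 1 n, c <- enum 'I_(X i)].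

Lemma mem_parts_upto (X : coloration) n (p : colored_part X) :
  (p \in parts_upto X n) = (0 < tag p <= n)%N.
Proof.
apply/allpairsPdep/idP => [[i [c [+ _ ->]]] /=|].
  by rewrite mem_iota add1n ltnS.
case: p => i c /= i_n; exists i, c; split=> //; last by rewrite mem_enum.
by rewrite mem_iota add1n ltnS.
Qed.

Lemma uniq_parts_upto (X : coloration) n : uniq (parts_upto X n).
Proof.
apply: allpairs_uniq_dep => [|i _|]; [exact: iota_uniq|exact: enum_uniq|].
by move=> [i c] [j d] _ _ /=.
Qed.

Lemma mem_colored_compositions (X : coloration) n (s : seq (colored_part X)) :
  (s \in fset_set (colored_compositions X n)) =
  all (fun p => 0 < tag p)%N s && (\sum_(p <- s) tag p == n)%N.
Proof.
rewrite in_fset_set; last exact: finite_colored_compositions.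
by apply/idP/idP => [/set_mem[-> ->]|/andP[s0 /eqP sn]];
  [rewrite eqxx|apply/mem_set].
Qed.

Lemma num_colored_compositions0 (X : coloration) :
  num_colored_compositions X 0 = 1%N.
Proof.
rewrite /num_colored_compositions -(cardfs1 ([::] : seq (colored_part X))).
congr (#|` _|%fset); apply/fsetP => s; rewrite mem_colored_compositions in_fset1.
case: s => [|p s]; first by rewrite big_nil.
by rewrite big_cons /= addn_eq0; case: (tag p) => [|k]; rewrite ?andbF.
Qed.

(** A nonempty composition is its first part followed by an arbitrary, possibly
    empty, composition of what is left of [n.+1]. *)
Lemma num_colored_compositionsS (X : coloration) n :
  num_colored_compositions X n.+1 =
  (\sum_(i < n.+1) X i.+1 * num_colored_compositions X (n - i))%N.
Proof.
pose E m := enum_fset (fset_set (colored_compositions X m)).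
pose L := [seq p :: s | p <- parts_upto X n.+1, s <- E (n.+1 - tag p)%N].
have uL : uniq L.
  apply: allpairs_uniq_dep => [|p _|]; first exact: uniq_parts_upto.
    exact: fset_uniq.
  by move=> [p s] [q u] _ _ /= [-> ->].
have memL : L =i E n.+1.
  move=> [|p s]; rewrite [RHS]mem_colored_compositions.
    by rewrite big_nil; apply/allpairsPdep => -[p [s [_ _]]].
  rewrite big_cons /= -andbA.
  apply/allpairsPdep/and3P => [[q [u [+ + [-> ->]]]]|[p0 s0 /eqP psn]].
    rewrite mem_parts_upto mem_colored_compositions => /andP[-> qn].
    by move=> /andP[-> /eqP ->]; rewrite subnKC.
  exists p, s; rewrite mem_parts_upto mem_colored_compositions p0 s0 -psn.
  by rewrite leq_addr addKn eqxx.
rewrite /num_colored_compositions -/(E n.+1).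
rewrite -(perm_size (uniq_perm uL (fset_uniq _) memL)) size_allpairs_dep.
rewrite sumnE big_map big_allpairs_dep -[iota _ _]/(index_iota 1 n.+2).
rewrite big_add1 big_mkord; apply: eq_bigr => i _.
by rewrite big_enum /= sum_nat_const card_ord subSS.
Qed.

(** Multiplying by [t] shifts the coefficients, which undoes the shift in
    [gen_fun]; when [f] counts compositions, [1] counts the empty one. *)
Lemma coef_add1_varM (R : fieldType) (f : fps R) n :
  (1 + fps_var * f) n = if n is m.+1 then f m else 1.
Proof.
rewrite coef_fpsD coef_fps1 coef_fpsM big_ord_recl /= mul0r add0r.
case: n => [|n]; first by rewrite big_ord0 addr0.
rewrite big_ord_recl /= mul1r subSS subn0 add0r big1 ?addr0// => i _.
by rewrite mul0r.
Qed.

Lemma add1_varM_unit (R : fieldType) (f : fps R) :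
  1 + fps_var * f \is a GRing.unit.
Proof. by rewrite fps_unitE coef_add1_varM oner_neq0. Qed.

Lemma gen_fun_invertN1 (R : fieldType) (a : nat -> R) :
  gen_fun (invert (-1) a) = gen_fun a / (1 + fps_var * gen_fun a).
Proof.
rewrite seq_of_gen_funK; congr (_ / (_ + _)).
have -> : fps_const (-1) = -1 :> fps R.
  by apply: fpsP => -[|n] /=; rewrite ?oppr0.
by rewrite mulN1r mulNr opprK.
Qed.

Lemma gen_fun_inj (R : Type) (u v : nat -> R) :
  gen_fun u = gen_fun v -> forall n, (1 <= n)%N -> u n = v n.
Proof.
by move=> uv [//|n] _; have := congr1 (fun f : fps R => f n) uv.
Qed.

(** The first-part recurrence is a convolution of the color counts with the
    composition counts, the latter including the empty composition. *)
Lemma gen_fun_colored_compositions (R : fieldType) (X : coloration)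
    (a : nat -> R) : counts_colored_compositions X a ->
  gen_fun a = gen_fun (fun i => (X i)%:R) * (1 + fps_var * gen_fun a).
Proof.
move=> Xa; apply: fpsP => n; rewrite coef_fpsM [LHS]Xa//.
rewrite num_colored_compositionsS natr_sum; apply: eq_bigr => i _.
rewrite natrM coef_add1_varM; congr (_ * _).
by case: (n - i)%N => [|m] /=; rewrite ?num_colored_compositions0 ?Xa.
Qed.

(** Both equations are linear in the unknown series, with coefficient
    [1 - t * z], whose constant term is [1]. *)
Lemma first_part_eq_inj (R : fieldType) (z f g : fps R) :
  f = z * (1 + fps_var * f) -> g = z * (1 + fps_var * g) -> f = g.
Proof.
have solve h : h = z * (1 + fps_var * h) -> h * (1 + fps_var * - z) = z.
  move=> hE; rewrite mulrDr mulr1 {1}hE mulrDr mulr1 -addrA.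
  by rewrite mulrN mulrN mulrCA [h * _]mulrCA [z * h]mulrC subrr addr0.
move=> /solve fz /solve gz; apply: (mulIr (add1_varM_unit _ (- z))).
by rewrite fz gz.
Qed.

Theorem theorem3 (R : realType) (a : nat -> R) :
  ((exists X : coloration, counts_colored_compositions X a) <->
   (forall n : nat, (1 <= n)%N -> invert (-1) a n \is a Num.nat)) /\
  (forall X : coloration, counts_colored_compositions X a ->
     (forall i : nat, (1 <= i)%N -> (X i)%:R = invert (-1) a i) /\
     gen_fun (fun i => (X i)%:R) =
       gen_fun a / (1 + fps_var * gen_fun a)).
Proof.
have colorationE X : counts_colored_compositions X a ->
    gen_fun (fun i => (X i)%:R) = gen_fun a / (1 + fps_var * gen_fun a).
  move=> /gen_fun_colored_compositions aE.
  by rewrite {1}aE mulrK// add1_varM_unit.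
have coefE X : counts_colored_compositions X a ->
    forall i, (1 <= i)%N -> (X i)%:R = invert (-1) a i.
  by move=> Xa; apply: gen_fun_inj; rewrite gen_fun_invertN1 colorationE.
split; last by move=> X Xa; split; [exact: coefE|exact: colorationE].
split=> [[X Xa] n n1|a_nat]; first by rewrite -(coefE X)// natr_nat.
pose X : coloration := fun i => Num.truncn (invert (-1) a i).
pose b n : R := (num_colored_compositions X n)%:R.
have XE : gen_fun (fun i => (X i)%:R) = gen_fun a / (1 + fps_var * gen_fun a).
  by rewrite -gen_fun_invertN1; apply: fpsP => n /=; rewrite truncnK// a_nat.
exists X; apply: (@gen_fun_inj R a b).
apply: (@first_part_eq_inj R (gen_fun (fun i => (X i)%:R))).
  by rewrite XE divrK// add1_varM_unit.
exact: gen_fun_colored_compositions.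
Qed.
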